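(* Let $S\subseteq\mathbb{N}^d$ be a simplicial affine semigroup with extremal rays $\mathbf{a}_1,\dots,\mathbf{a}_d$, let $E=\{\mathbf{a}_1,\dots,\mathbf{a}_d\}$, and let $\mathbb{K}$ be a field. If $\mathbb{K}[S]$ is a Cohen-Macaulay ring and $\max_{\preceq_c}\operatorname{Ap}(S,E)=\{\mathbf{w}\}$, then $\mathfrak{c}(S)$ is generated by $$\{\mathbf{w}-\mathbf{b} : \mathbf{b}\in\max\nolimits_{\preceq_c}r(\operatorname{Ap}(S,E))\}$$ as an ideal of $\bar S$. In particular, if $\max_{\preceq_c}r(\operatorname{Ap}(S,E))=\{\mathbf{b}\}$, then $\mathfrak{c}(S)$ is a principal ideal of $\bar S$ generated by $\mathbf{w}-\mathbf{b}$.
   Context: $\mathbb{N}$ denotes the nonnegative integers and $d\ge 1$. An affine semigroup is a finitely generated submonoid $S$ of $\mathbb{N}^d$; it has a unique minimal generating set $\operatorname{mgs}(S)$. $S$ is simplicial if there are $d$ elements of $\operatorname{mgs}(S)$, linearly independent over $\mathbb{Q}$, such that every $\mathbf{a}\in S$ has a positive multiple $n\mathbf{a}$ that is an $\mathbb{N}$-linear combination of these $d$ elements. Equivalently, $\operatorname{cone}(S)$, the set of nonnegative real combinations of elements of $S$, has exactly $d$ one-dimensional extremal rays. The smallest nonzero element of $S$ on each of these rays is called an extremal ray of $S$; these are $\mathbf{a}_1,\dots,\mathbf{a}_d$, and they form a basis of $\mathbb{R}^d$ and span $\operatorname{cone}(S)$. $\mathbb{K}[S]\subseteq\mathbb{K}[x_1,\dots,x_d]$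 is the subalgebra spanned by the monomials $\mathbf{x}^{\mathbf{a}}$, $\mathbf{a}\in S$. $P_S=\{\sum_{i=1}^d\lambda_i\mathbf{a}_i : 0\le\lambda_i<1\text{ for all } i\}$. Every $\mathbf{a}\in\operatorname{cone}(S)\cap\mathbb{N}^d$ is uniquely $\mathbf{a}=\sum_{i=1}^d n_i\mathbf{a}_i+r(\mathbf{a})$ with $n_i\in\mathbb{N}$ and $r(\mathbf{a})\in P_S\cap\mathbb{N}^d$. $\operatorname{Ap}(S,E)=\{\mathbf{a}\in S : \mathbf{a}-\mathbf{a}_i\notin S\text{ for all } i\}$, a finite set, and $r(\operatorname{Ap}(S,E))=\{r(\mathbf{v}) : \mathbf{v}\in\operatorname{Ap}(S,E)\}$. The partial order $\preceq_c$ on $\mathbb{N}^d$ is: $\mathbf{x}\preceq_c\mathbf{y}$ iff $\mathbf{y}-\mathbf{x}\in\operatorname{cone}(S)$; $\max_{\preceq_c}X$ denotes the set of maximal elements of $X$. $\operatorname{group}(S)=\{\mathbf{a}-\mathbf{b} : \mathbf{a},\mathbf{b}\in S\}$; the normalization of $S$ is $\bar S=\operatorname{group}(S)\cap\operatorname{cone}(S)$; the conductor of $S$ is $\mathfrak{c}(S)=\{\mathbf{b}\in S : \mathbf{b}+\bar S\subseteq S\}$, an ideal of $\bar S$. A set $B$ generates an ideal $H$ of $\bar S$ if $H=B+\bar S$; $H$ is principal if it is generated by one element. *)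

(* Defs.v *)
From HB Require Import structures.
From mathcomp Require Import all_boot all_order all_algebra.
From mathcomp Require Import boolp classical_sets reals.
From mathcomp Require Import mpoly.

Set Implicit Arguments.
Unset Strict Implicit.
Unset Printing Implicit Defensive.

Import Order.TTheory GRing.Theory Num.Theory.

Local Open Scope classical_set_scope.
Local Open Scope ring_scope.

(* A Noetherian ring is Cohen-Macaulay when depth(P) = codim(P) for every maximal
   ideal P, where codim(P) is the height of P and depth(P) is the length of a
   longest regular sequence contained in P (Eisenbud, Commutative Algebra,
   Section 18.2).  [idealr_closed] is the library notion of a proper ideal. *)

Section CohenMacaulay.

Variable A : comNzRingType.
Implicit Types (P Q : set A) (s : seq A) (n : nat).

Definition ideal_gen s : set A :=
  [set x | exists c : 'I_(size s) -> A, x = \sum_i c i * s`_i].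

(* The improper ideal is generated by 1, so it may be left out. *)
Definition noetherian : Prop :=
  forall P, idealr_closed (mem P) -> exists s, P = ideal_gen s.

Definition prime_ideal P : Prop :=
  idealr_closed (mem P) /\ prime_idealr_closed (mem P).

Definition maximal_ideal P : Prop :=
  idealr_closed (mem P) /\
  forall Q, idealr_closed (mem Q) -> P `<=` Q -> Q = P.

Definition prime_chain P n : Prop :=
  exists Q : nat -> set A,
    [/\ forall i, (i <= n)%N -> prime_ideal (Q i),
        forall i, (i < n)%N -> Q i `<` Q i.+1
      & Q n = P].

Definition regular_seq s : Prop :=
  (forall i, (i < size s)%N -> forall x,
     ideal_gen (take i s) (s`_i * x) -> ideal_gen (take i s) x) /\
  ~ ideal_gen s 1.

Definition regular_seq_in P n : Prop :=
  exists s, [/\ size s = n, [set` s] `<=` P & regular_seq s].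

Definition is_largest (L : nat -> Prop) n : Prop :=
  L n /\ forall m, L m -> (m <= n)%N.

Definition codim_eq P n : Prop := is_largest (prime_chain P) n.

Definition depth_eq P n : Prop := is_largest (regular_seq_in P) n.

Definition cohen_macaulay : Prop :=
  noetherian /\
  forall P, maximal_ideal P -> exists n, codim_eq P n /\ depth_eq P n.

End CohenMacaulay.

(* 'X_{1..d} plays the role of N^d. *)

Definition submonoid_gen d (G : set 'X_{1..d}) : set 'X_{1..d} :=
  [set m | exists2 s : seq 'X_{1..d},
     [set` s] `<=` G & m = (\sum_(x <- s) x)%MM].

Record affine_semigroup d := AffineSemigroup {
  asg_set :> set 'X_{1..d};
  asg0 : asg_set 0%MM;
  asgD : forall x y, asg_set x -> asg_set y -> asg_set (x + y)%MM;
  asg_fg : exists s : seq 'X_{1..d}, asg_set = submonoid_gen [set` s]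
}.

(* K[S], the span of the monomials x^m with m in S, is the set of polynomials
   all of whose exponents lie in S. *)

Definition sgring_pred (K : fieldType) d (S : affine_semigroup d) :
  {pred {mpoly K[d]}} := fun p => all (mem (asg_set S)) (msupp p).

Arguments sgring_pred K {d} S.

Lemma sgring_predP (K : fieldType) d (S : affine_semigroup d) (p : {mpoly K[d]}) :
  reflect (forall m, p@_m != 0 -> asg_set S m) (p \in sgring_pred K S).
Proof.
apply: (iffP allP) => [Sp m pm|Sp m pm].
  by have := Sp m; rewrite mcoeff_msupp => /(_ pm); rewrite !inE.
by rewrite !inE; apply: Sp; rewrite -mcoeff_msupp.
Qed.

Lemma sgring_pred_subring (K : fieldType) d (S : affine_semigroup d) :
  subring_closed (sgring_pred K S).
Proof.
split=> [|p q /sgring_predP Sp /sgring_predP Sq|p q /sgring_predP Sp /sgring_predP Sq].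
- apply/sgring_predP => m; rewrite mcoeff1.
  by have [-> _|_] := eqVneq m 0%MM; [exact: asg0 | rewrite eqxx].
- apply/sgring_predP => m; rewrite mcoeffB => pq.
  have [p0|/Sp//] := eqVneq p@_m 0; apply: Sq.
  by apply: contra_neq pq => q0; rewrite p0 q0 subrr.
- apply/sgring_predP => m; rewrite -mcoeff_msupp => /msuppM_le.
  by case/allpairsP => -[x y] /= [+ + ->]; rewrite !mcoeff_msupp => /Sp Sx /Sq Sy;
     apply: asgD.
Qed.

HB.instance Definition _ (K : fieldType) d (S : affine_semigroup d) :=
  GRing.isSubringClosed.Build {mpoly K[d]} (sgring_pred K S)
    (@sgring_pred_subring K d S).

Record semigroup_ring (K : fieldType) d (S : affine_semigroup d) :=
  SemigroupRing { sgring_val : {mpoly K[d]}; _ : sgring_val \in sgring_pred K S }.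

Arguments semigroup_ring K {d} S.

HB.instance Definition _ (K : fieldType) d (S : affine_semigroup d) :=
  [isSub for @sgring_val K d S].
HB.instance Definition _ (K : fieldType) d (S : affine_semigroup d) :=
  [Choice of semigroup_ring K S by <:].
HB.instance Definition _ (K : fieldType) d (S : affine_semigroup d) :=
  [SubChoice_isSubComNzRing of semigroup_ring K S by <:].

Definition mnm_row (F : nzRingType) d (m : 'X_{1..d}) : 'rV[F]_d :=
  \row_i (m i)%:R.

Arguments mnm_row F {d} m.

Section Simplicial.

Variables (R : realType) (d : nat) (S : affine_semigroup d).

Definition cone : set 'rV[R]_d :=
  [set x | exists n (m : 'I_n -> 'X_{1..d}) (t : 'I_n -> R),
     [/\ forall i, asg_set S (m i), forall i, 0 <= t i
       & x = \sum_i t i *: mnm_row R (m i)]].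

Definition min_gen_set (G : set 'X_{1..d}) : Prop :=
  submonoid_gen G = S /\
  forall G', G' `<=` G -> submonoid_gen G' = S -> G' = G.

Definition simplicial : Prop :=
  exists2 G, min_gen_set G &
  exists e : 'I_d -> 'X_{1..d},
    [/\ forall i, G (e i),
        row_free (\matrix_(i < d) mnm_row rat (e i))
      & forall x, asg_set S x -> exists n (c : 'I_d -> nat),
          (0 < n)%N /\ (x *+ n = \sum_(i < d) e i *+ c i)%MM].

Definition ray (v : 'rV[R]_d) : set 'rV[R]_d :=
  [set t *: v | t in [set t : R | 0 <= t]].

(* The ray through v is a one-dimensional face of cone(S). *)
Definition spans_extremal_ray (v : 'rV[R]_d) : Prop :=
  [/\ cone v, v != 0
    & forall x y, cone x -> cone y -> ray v (x + y) -> ray v x /\ ray v y].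

Definition extremal_ray (m : 'X_{1..d}) : Prop :=
  [/\ asg_set S m, spans_extremal_ray (mnm_row R m)
    & forall m', asg_set S m' -> m' != 0%MM -> ray (mnm_row R m) (mnm_row R m') ->
        (m <= m')%MM].

(* a_1, ..., a_d is a list without repetition of all extremal rays of S. *)
Definition extremal_rays (a : 'I_d -> 'X_{1..d}) : Prop :=
  injective a /\ range a = [set m | extremal_ray m].

Definition cone_le (x y : 'X_{1..d}) : Prop :=
  cone (mnm_row R y - mnm_row R x).

Definition cone_max (X : set 'X_{1..d}) : set 'X_{1..d} :=
  [set x | X x /\ forall y, X y -> cone_le x y -> y = x].

Definition zsemigroup : set 'rV[int]_d := mnm_row int @` S.

Definition apery (a : 'I_d -> 'X_{1..d}) : set 'X_{1..d} :=
  [set x | asg_set S x /\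
     forall i, ~ zsemigroup (mnm_row int x - mnm_row int (a i))].

Definition parallelotope (a : 'I_d -> 'X_{1..d}) : set 'rV[R]_d :=
  [set x | exists2 l : 'I_d -> R, forall i, 0 <= l i < 1
     & x = \sum_i l i *: mnm_row R (a i)].

(* The relation r = r(x): the decomposition is unique, as a_1, ..., a_d is a
   basis of R^d. *)
Definition is_remainder (a : 'I_d -> 'X_{1..d}) (x r : 'X_{1..d}) : Prop :=
  parallelotope a (mnm_row R r) /\
  exists n : 'I_d -> nat, x = (\sum_(i < d) a i *+ n i + r)%MM.

Definition remainders (a : 'I_d -> 'X_{1..d}) (X : set 'X_{1..d}) :
    set 'X_{1..d} :=
  [set r | exists2 x, X x & is_remainder a x r].

Definition sgroup : set 'rV[int]_d :=
  [set x - y | x in zsemigroup & y in zsemigroup].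

Definition normalization : set 'rV[int]_d :=
  [set x | sgroup x /\ cone (map_mx intr x)].

Definition conductor : set 'rV[int]_d :=
  [set b | zsemigroup b /\
     forall x, normalization x -> zsemigroup (b + x)].

Definition generates (B H : set 'rV[int]_d) : Prop :=
  H = [set b + x | b in B & x in normalization].

End Simplicial.

(* Main.v *)
Require Import Defs.
From HB Require Import structures.
From mathcomp Require Import all_boot all_order all_algebra.
From mathcomp Require Import boolp classical_sets reals.
From mathcomp Require Import mpoly.
From mathcomp Require Import ring lra zify.

Set Implicit Arguments.
Unset Strict Implicit.
Unset Printing Implicit Defensive.

Import Order.TTheory GRing.Theory Num.Theory.

Local Open Scope classical_set_scope.
Local Open Scope ring_scope.

(** The irrelevant maximal ideal of K[S] has height at least d, as the faces of
    the simplicial cone give a chain of d + 1 primes; so it contains a regular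
    sequence of length d. By depth sensitivity of the Koszul complex, every
    relation among monomials x^(e_1), ..., x^(e_d), where e_l is a positive
    multiple of a_l, is then trivial. Applied to x^u x^(a_j) = x^v x^(a_i), this
    shows: if g + a_i and g + a_j lie in S with i <> j, then so does g. Hence each
    class of group(S) modulo the lattice spanned by the a_i contains exactly one
    Apery element v, and v + sum z_i a_i is in S iff all z_i >= 0.

    Now compare coordinates with respect to the basis a_1, ..., a_d. Every Apery
    element lies below w, and every remainder b has coordinates < 1; so if x is in
    the normalization and w - b + x = v + sum z_i a_i, all z_i > -1, that is,
    w - b + x is in S. Conversely, for c in the conductor let y be the
    representative of w - c in P_S: it is the remainder of an Apery element, and
    c + y, being in S and congruent to w, lies above w; any maximal b above y then
    has c - (w - b) in the normalization. *)

(** * Computing modulo finitely generated ideals *)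

Section IdealGen.

Variable A : comNzRingType.
Implicit Types (s : seq A) (x y f : A).

(** Coefficients indexed by [nat] keep their type when [s] is extended or truncated. *)
Lemma ideal_genP s x :
  ideal_gen s x <-> exists c : nat -> A, x = \sum_(i < size s) c i * s`_i.
Proof.
split=> [[c ->]|[c ->]]; last by exists (fun i => c i).
exists (fun k => if insub k is Some i then c i else 0).
by apply: eq_bigr => i _; rewrite valK.
Qed.

Lemma ideal_gen0 s : ideal_gen s 0.
Proof. by exists (fun=> 0); rewrite big1 // => i _; rewrite mul0r. Qed.

Lemma ideal_genD s x y : ideal_gen s x -> ideal_gen s y -> ideal_gen s (x + y).
Proof.
move=> [c ->] [c' ->]; exists (fun i => c i + c' i).
by rewrite -big_split; apply: eq_bigr => i _; rewrite mulrDl.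
Qed.

Lemma ideal_genM s x y : ideal_gen s y -> ideal_gen s (x * y).
Proof.
move=> [c ->]; exists (fun i => x * c i).
by rewrite mulr_sumr; apply: eq_bigr => i _; rewrite mulrA.
Qed.

Lemma ideal_genN s x : ideal_gen s x -> ideal_gen s (- x).
Proof. by rewrite -mulN1r; apply: ideal_genM. Qed.

Lemma ideal_gen_sum s (I : finType) (P : pred I) (F : I -> A) :
  (forall i, P i -> ideal_gen s (F i)) -> ideal_gen s (\sum_(i | P i) F i).
Proof.
by move=> sF; apply: (big_ind (ideal_gen s)) => //;
  [apply: ideal_gen0 | apply: ideal_genD].
Qed.

(** Peeling off the last generator allows work modulo successive segments of a sequence without
    forming quotient rings. *)
Lemma ideal_gen_rcons s f x :
  ideal_gen (rcons s f) x <-> exists g, ideal_gen s (x - f * g).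
Proof.
split=> [/ideal_genP[c]|[g /ideal_genP[c]]].
  rewrite size_rcons big_ord_recr /= nth_rcons ltnn eqxx => ->.
  exists (c (size s)); rewrite mulrC addrK; apply/ideal_genP; exists c.
  by apply: eq_bigr => i _; rewrite nth_rcons ltn_ord.
move/eqP; rewrite subr_eq => /eqP ->; apply/ideal_genP.
exists (fun k => if (k < size s)%N then c k else g).
rewrite size_rcons big_ord_recr /= nth_rcons !ltnn eqxx mulrC; congr (_ + _).
by apply: eq_bigr => i _; rewrite nth_rcons !ltn_ord.
Qed.

Lemma ideal_gen_take_S s q x : (q < size s)%N ->
  ideal_gen (take q.+1 s) x <-> exists g, ideal_gen (take q s) (x - s`_q * g).
Proof.
move=> ltqs; by rewrite (take_nth 0) // ideal_gen_rcons.
Qed.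

End IdealGen.

(** * The radical of the ideal generated by a finite family *)

Section Radical.

Variables (A : comNzRingType) (d : nat) (y : 'I_d -> A).
Implicit Types f g x : A.

Definition fam_ideal x := exists r : 'I_d -> A, x = \sum_i r i * y i.

Definition fam_radical f := exists k, fam_ideal (f ^+ k).

Lemma fam_idealD f g : fam_ideal f -> fam_ideal g -> fam_ideal (f + g).
Proof.
move=> [r ->] [r' ->]; exists (fun i => r i + r' i).
by rewrite -big_split; apply: eq_bigr => i _; rewrite mulrDl.
Qed.

Lemma fam_idealM f g : fam_ideal g -> fam_ideal (f * g).
Proof.
move=> [r ->]; exists (fun i => f * r i).
by rewrite mulr_sumr; apply: eq_bigr => i _; rewrite mulrA.
Qed.

Lemma fam_ideal0 : fam_ideal 0.
Proof. by exists (fun=> 0); rewrite big1 // => i _; rewrite mul0r. Qed.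

Lemma fam_ideal_mem i : fam_ideal (y i).
Proof.
exists (fun j => (j == i)%:R); rewrite (bigD1 i) //= eqxx mul1r big1 ?addr0 //.
by move=> j /negPf ->; rewrite mul0r.
Qed.

Lemma fam_radical0 : fam_radical 0.
Proof. by exists 1%N; rewrite expr1; apply: fam_ideal0. Qed.

Lemma fam_radicalM f g : fam_radical g -> fam_radical (f * g).
Proof. by move=> [k gk]; exists k; rewrite exprMn; apply: fam_idealM. Qed.

(** In each binomial term of [(f + g) ^+ (k + l)], either [g] has exponent at least [l] or [f] has
    exponent at least [k]. *)
Lemma fam_radicalD f g : fam_radical f -> fam_radical g -> fam_radical (f + g).
Proof.
move=> [k fk] [l gl]; exists (k + l)%N; rewrite exprDn.
apply: (big_ind fam_ideal); [exact: fam_ideal0 | exact: fam_idealD | move=> i _].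
rewrite -mulr_natl; apply: fam_idealM.
have [li|il] := leqP l i.
  by rewrite -(subnK li) exprD mulrA; apply: fam_idealM.
have -> : (k + l - i = (l - i) + k)%N by rewrite -addnBA 1?ltnW // addnC.
by rewrite mulrC exprD mulrA; apply: fam_idealM.
Qed.

End Radical.

(** * Koszul cochains and depth *)

Section Koszul.

Variables (A : comNzRingType) (d : nat) (y : 'I_d -> A).
Implicit Types (F : {set 'I_d}) (c b : {set 'I_d} -> A) (J : seq A).

Definition ksign (i : 'I_d) F : A := (-1) ^+ #|[set j in F | (j < i)%N]|.

(* The Koszul cochain complex of [y]; [c F] is the coefficient of [e_F], and only
   the sets [F] of size [p] matter for a cochain of degree [p]. *)
Definition kdiff c F : A := \sum_(i in F) ksign i F * (y i * c (F :\ i)).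

(* Contraction with the [k]-th basis vector: a homotopy between [y k] and 0. *)
Definition kcontr k c F : A := if k \in F then 0 else ksign k F * c (k |: F).

Lemma ksign_sqr i F : ksign i F * ksign i F = 1.
Proof. by rewrite /ksign -expr2 sqrr_sign. Qed.

Lemma ksignU i k F : k \notin F ->
  ksign i (k |: F) = (-1) ^+ (k < i)%N * ksign i F.
Proof.
move=> kF; rewrite /ksign -exprD; congr (_ ^+ _).
have [ki|ki] := boolP (k < i)%N.
  have -> : [set j in k |: F | (j < i)%N] = k |: [set j in F | (j < i)%N].
    by apply/setP => j; rewrite !inE; case: eqP => // ->; rewrite ki.
  by rewrite cardsU1 inE (negPf kF).
congr #|pred_of_set _|; apply/setP => j; rewrite !inE.
by case: eqP => // ->; rewrite (negPf ki) (negPf kF).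
Qed.

Lemma ksignD i k F : k \in F ->
  ksign i (F :\ k) = (-1) ^+ (k < i)%N * ksign i F.
Proof.
move=> kF; rewrite -{2}(finset.setD1K kF) ksignU ?finset.setD11 //.
by rewrite mulrA -expr2 sqrr_sign mul1r.
Qed.

Lemma kdiffK c F : kdiff (kdiff c) F = 0.
Proof.
rewrite /kdiff.
(* The terms for [(i, j)] and [(j, i)] remove the same two indices with opposite signs, so they
   cancel in pairs. *)
pose t i j := ksign i F * (y i * (ksign j (F :\ i) * (y j * c (F :\ i :\ j)))).
have tN i j : i \in F -> j \in F -> (j < i)%N -> t i j = - t j i.
  move=> iF jF ji; rewrite /t !ksignD // ji ltnNge (ltnW ji) /= expr0 expr1.
  have -> : F :\ j :\ i = F :\ i :\ j by rewrite !finset.setDDl finset.setUC.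
  by ring.
rewrite (eq_bigr (fun i : 'I_d => \sum_(j in F | (j < i)%N) t i j
                         + \sum_(j in F | (i < j)%N) t i j)); last first.
  move=> i iF; rewrite !mulr_sumr (bigID (fun j : 'I_d => (j < i)%N)) /=.
  by congr (_ + _); apply: eq_bigl => j; rewrite !inE -val_eqE /=;
     case: (ltngtP j i); rewrite ?andbT ?andbF.
rewrite big_split /= [X in _ + X](exchange_big_dep (fun j => j \in F)) /=; last first.
  by move=> i j _ /andP[].
rewrite -big_split big1 // => i iF /=; rewrite iF /=.
rewrite -big_split big1 // => j /andP[jF ji] /=.
by apply/eqP; rewrite addr_eq0 tN.
Qed.


(** If [k] is in [F], only the term [i = k] of the first summand survives. Otherwise the terms with
    [i] in [F] cancel between the two summands, leaving the term [i = k] of [kdiff c] at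
    [k |: F]. *)
Lemma kcontr_kdiff k c F :
  kdiff (kcontr k c) F + kcontr k (kdiff c) F = y k * c F.
Proof.
rewrite {2}/kcontr; have [kF|kF] := boolP (k \in F).
  rewrite addr0 /kdiff (bigD1 k) //= big1 => [|i /andP[iF ik]]; last first.
    by rewrite /kcontr !inE eq_sym ik kF !mulr0.
  rewrite /kcontr finset.setD11 finset.setD1K // addr0 ksignD // ltnn mul1r.
  by rewrite mulrCA (mulrA (ksign k F)) ksign_sqr mul1r.
rewrite /kdiff big_setU1 //= finset.setU1K // mulrDr addrCA.
rewrite mulrA ksignU // ltnn mul1r ksign_sqr mul1r.
rewrite mulr_sumr -big_split big1 ?addr0 //= => i iF.
have ik : i != k by apply: contraNneq kF => <-.
rewrite /kcontr !inE (negPf kF) andbF ksignD // ksignU //.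
have -> : k |: F :\ i = (k |: F) :\ i.
  by apply/setP => j; rewrite !inE; case: (eqVneq j k) => // ->; rewrite eq_sym ik.
move: ik; rewrite -val_eqE /=; case: (ltngtP i k) => //= _ _; ring.
Qed.

Lemma kdiffD c b F : kdiff (fun G => c G + b G) F = kdiff c F + kdiff b F.
Proof.
by rewrite -big_split; apply: eq_bigr => i _; rewrite !mulrDr.
Qed.

Lemma kdiffZ x c F : kdiff (fun G => x * c G) F = x * kdiff c F.
Proof.
by rewrite /kdiff mulr_sumr; apply: eq_bigr => i _; ring.
Qed.

Definition kcocycle J p c := forall F, #|F| = p.+1 -> ideal_gen J (kdiff c F).

(** For [p = 0] the differential is an empty sum, so the condition says that the value of [c] at the
    empty set lies in the ideal. *)
Definition kcobound J p c :=
  exists b, forall F, #|F| = p -> ideal_gen J (c F - kdiff b F).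

Lemma kdiff_ideal J p c : (forall F, #|F| = p -> ideal_gen J (c F)) ->
  forall F, #|F| = p.+1 -> ideal_gen J (kdiff c F).
Proof.
move=> Jc F cF; apply: ideal_gen_sum => i iF; do 2!apply: ideal_genM.
by apply: Jc; move: cF; rewrite (cardsD1 i) iF => -[].
Qed.

Lemma kcoboundD J p c b : kcobound J p c -> kcobound J p b ->
  kcobound J p (fun F => c F + b F).
Proof.
move=> [c' cc'] [b' bb']; exists (fun F => c' F + b' F) => F cF.
by rewrite kdiffD opprD addrACA; apply: ideal_genD; [apply: cc' | apply: bb'].
Qed.

Lemma kcoboundZ J p x c : kcobound J p c -> kcobound J p (fun F => x * c F).
Proof.
move=> [b cb]; exists (fun F => x * b F) => F cF.
by rewrite kdiffZ -mulrBr; apply: ideal_genM; apply: cb.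
Qed.

Lemma kcobound_eq J p c b : c =1 b -> kcobound J p c -> kcobound J p b.
Proof. by move=> /funext ->. Qed.

(** By the homotopy formula, [kcontr k c] is a primitive modulo [J]; thus [y k] annihilates
    cohomology. *)
Lemma kcobound_mul J p k c : kcocycle J p c -> kcobound J p (fun F => y k * c F).
Proof.
move=> Jc; exists (kcontr k c) => F cF; rewrite -(kcontr_kdiff k c) addrAC subrr.
rewrite add0r /kcontr; case: ifPn => kF; first exact: ideal_gen0.
by apply: ideal_genM; apply: Jc; rewrite cardsU1 kF cF.
Qed.

Lemma kcobound_ideal J p c (r : 'I_d -> A) : kcocycle J p c ->
  kcobound J p (fun F => (\sum_i r i * y i) * c F).
Proof.
move=> Jc; pose g i F := r i * (y i * c F).
apply: (@kcobound_eq _ _ (fun F => \sum_i g i F)) => [F|].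
  by rewrite mulr_suml; apply: eq_bigr => i _; rewrite /g mulrA.
elim: (index_enum _) => [|i s IHs].
  exists (fun=> 0) => F _; rewrite big_nil /kdiff big1 ?subrr; last first.
    by move=> i _; rewrite !mulr0.
  exact: ideal_gen0.
apply: (@kcobound_eq _ _ (fun F => g i F + \sum_(j <- s) g j F)) => [F|].
  by rewrite big_cons.
by apply: kcoboundD => //; apply: kcoboundZ; apply: kcobound_mul.
Qed.

Section RegularSeq.

Variable s : seq A.
Hypotheses (regs : regular_seq s)
  (rads : forall f, f \in s -> fam_radical y f).

(* Depth sensitivity of the Koszul complex. If [f = s`_q] kills the class of a
   cocycle [c], say [f * c = kdiff b], then [b] is a cocycle modulo [f] of one
   degree less, and it bounds only if [c] does. *)
Lemma koszul_acyclic p q c : (p + q < size s)%N ->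
  kcocycle (take q s) p c -> kcobound (take q s) p c.
Proof.
elim: p q c => [|p IHp] q c ltqs Jc.
  (* In degree 0 a cocycle is killed modulo the ideal by every [y i], hence by a power of the next
     element of [s]; regularity then removes that power. *)
  exists (fun=> 0) => F /cards0_eq ->; rewrite /kdiff finset.big_set0 subr0.
  have [k [r fk]] := rads (mem_nth 0 ltqs).
  have Jfc : ideal_gen (take q s) (s`_q ^+ k * c finset.set0).
    rewrite fk mulr_suml; apply: ideal_gen_sum => i _.
    rewrite -mulrA; apply: ideal_genM.
    have := Jc [set i]%SET; rewrite cards1 /kdiff big_set1 finset.setDv => /(_ erefl).
    by move=> /(ideal_genM (ksign i [set i]%SET)); rewrite mulrA ksign_sqr mul1r.
  elim: k {fk} Jfc => [|k IHk]; first by rewrite mul1r.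
  by rewrite exprS -mulrA => /(proj1 regs _ ltqs).
have ltq : (q < size s)%N by apply: leq_trans ltqs; rewrite ltnS leq_addl.
have [k [r fk]] := rads (mem_nth 0 ltq).
(* A power of the next element lies in the ideal of [y], so it kills the class; its factors are
   cancelled one at a time. *)
have : kcobound (take q s) p.+1 (fun F => s`_q ^+ k * c F).
  by rewrite fk; apply: kcobound_ideal.
elim: k {fk} => [|k IHk] Jfc; first by apply: kcobound_eq Jfc => F; rewrite mul1r.
apply: IHk; case: Jfc => b Jb.
have Jb' : kcocycle (take q.+1 s) p b.
  move=> F cF; apply/ideal_gen_take_S => //; exists (s`_q ^+ k * c F).
  by rewrite mulrA -exprS -opprB; apply/ideal_genN/Jb.
have [|e Je] := IHp _ _ _ Jb'; first by rewrite addnS -addSn.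
have /choice[g Jg] : forall F, exists g, #|F| = p ->
    ideal_gen (take q s) (b F - kdiff e F - s`_q * g).
  move=> F; have [cF|cF] := eqVneq #|F| p; last by exists 0 => /eqP; rewrite (negPf cF).
  by have /(ideal_gen_take_S _ ltq)[g Jg] := Je _ cF; exists g.
(* Applying [kdiff] to [Jg] eliminates [e]. Regularity cancels the common factor, and [g] is a
   primitive with one power fewer. *)
exists g => F cF; apply: (proj1 regs _ ltq).
have /= := kdiff_ideal Jg cF.
rewrite kdiffD (kdiffD b) -/(kdiff _ _).
have -> : kdiff (fun G => - kdiff e G) F = - kdiff (kdiff e) F.
  by rewrite /kdiff -sumrN; apply: eq_bigr => i _; rewrite !mulrN.
have -> : kdiff (fun G => - (s`_q * g G)) F = - (s`_q * kdiff g F).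
  by rewrite -kdiffZ /kdiff -sumrN; apply: eq_bigr => i _; rewrite !mulrN.
rewrite kdiffK oppr0 addr0 => /(ideal_genD (Jb F cF)).
by rewrite addrA subrK mulrBr mulrA -exprS.
Qed.

End RegularSeq.

End Koszul.

(** * Prime ideals of the semigroup ring *)

Section SemigroupRing.

Variables (K : fieldType) (d : nat) (S : affine_semigroup d).
Local Notation A := (semigroup_ring K S).
Implicit Types (p q : A) (m x y : 'X_{1..d}) (F : set 'X_{1..d}).

Lemma sgval_inj : injective (@sgring_val K d S).
Proof. exact: val_inj. Qed.

Lemma sgval0 : sgring_val (0 : A) = 0. Proof. by []. Qed.

Lemma sgval1 : sgring_val (1 : A) = 1. Proof. by []. Qed.

Lemma sgvalD p q : sgring_val (p + q) = sgring_val p + sgring_val q.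
Proof. by []. Qed.

Lemma sgvalB p q : sgring_val (p - q) = sgring_val p - sgring_val q.
Proof. exact: (raddfB (val : A -> {mpoly K[d]})). Qed.

Lemma sgvalM p q : sgring_val (p * q) = sgring_val p * sgring_val q.
Proof. by []. Qed.

Lemma sgval_sum (I : Type) (r : seq I) (P : pred I) (f : I -> A) :
  sgring_val (\sum_(i <- r | P i) f i) = \sum_(i <- r | P i) sgring_val (f i).
Proof. exact: (raddf_sum (val : A -> {mpoly K[d]})). Qed.

(** The default value 0 is taken when [m] is not in [S]. *)
Definition sgmono m : A := insubd 0 'X_[m].

Definition sgconst (k : K) : A := insubd 0 k%:MP.

Lemma sgmonoE m : asg_set S m -> sgring_val (sgmono m) = 'X_[m].
Proof.
move=> Sm; rewrite -[sgring_val _]/(val _) val_insubd; case: ifP => // /negP[].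
by apply/sgring_predP => x; rewrite mcoeffX; case: (eqVneq m x) => [<-|_]; rewrite ?eqxx.
Qed.

Lemma sgconstE k : sgring_val (sgconst k) = k%:MP.
Proof.
rewrite -[sgring_val _]/(val _) val_insubd; case: ifP => // /negP[]; apply/sgring_predP => x.
rewrite mcoeffC; case: (eqVneq x 0%MM) => [-> _|_]; first exact: asg0.
by rewrite mulr0 eqxx.
Qed.

Lemma sgmonoD x y : asg_set S x -> asg_set S y ->
  sgmono (x + y)%MM = sgmono x * sgmono y.
Proof.
move=> Sx Sy; apply: sgval_inj; rewrite sgvalM !sgmonoE ?mpolyXD //.
exact: asgD.
Qed.

Lemma asgMn m n : asg_set S m -> asg_set S (m *+ n)%MM.
Proof.
move=> Sm; elim: n => [|n IHn]; first exact: asg0.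
by rewrite mulmS; apply: asgD.
Qed.

Lemma asg_sum (I : finType) (x : I -> 'X_{1..d}) :
  (forall i, asg_set S (x i)) -> asg_set S (\sum_i x i)%MM.
Proof.
by move=> Sx; apply: (big_ind (asg_set S)) => //; [apply: asg0 | apply: asgD].
Qed.

Lemma sgmonoX m n : asg_set S m -> sgmono (m *+ n)%MM = sgmono m ^+ n.
Proof.
move=> Sm; elim: n => [|n IHn].
  by apply: sgval_inj; rewrite expr0 sgval1 sgmonoE ?mpolyX0 //; apply: asg0.
by rewrite mulmS sgmonoD ?IHn ?exprS //; apply: asgMn.
Qed.

Lemma sgring_supp p m : (sgring_val p)@_m != 0 -> asg_set S m.
Proof. exact/sgring_predP/(valP p). Qed.

Lemma mcoeffM_eq0 (p q : {mpoly K[d]}) m :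
  (forall x y, m = (x + y)%MM -> p@_x = 0 \/ q@_y = 0) -> (p * q)@_m = 0.
Proof.
move=> pq0; apply/eqP; apply: contraT; rewrite -mcoeff_msupp => /msuppM_le.
case/allpairsP=> -[x y] /= []; rewrite !mcoeff_msupp => px qy /pq0[] E.
- by rewrite E eqxx in px.
- by rewrite E eqxx in qy.
Qed.

Lemma sgring_sum p :
  p = \sum_(m <- msupp (sgring_val p)) sgconst (sgring_val p)@_m * sgmono m.
Proof.
apply: sgval_inj; rewrite sgval_sum [LHS]mpolyE.
apply: eq_big_seq => m; rewrite mcoeff_msupp => /sgring_supp Sm.
by rewrite sgvalM sgconstE sgmonoE // mul_mpolyC.
Qed.

Definition face_ideal F : set A := [set p | forall m, F m -> (sgring_val p)@_m = 0].

(** [F] may contain exponents outside [S], as [coord_face] below does; only its trace on [S]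
    matters. *)
Definition is_face F := F 0%MM /\ forall x y, asg_set S x -> asg_set S y ->
  F (x + y)%MM <-> F x /\ F y.

Lemma face_ideal_closed F : is_face F -> idealr_closed (mem (face_ideal F)).
Proof.
move=> [F0 FD]; split=> [||p u v].
- by apply/mem_set => m _; rewrite sgval0 mcoeff0.
- apply/negP => /set_mem /(_ _ F0); rewrite sgval1 mcoeff1 eqxx.
  by move/eqP; rewrite oner_eq0.
move=> /set_mem u0 /set_mem v0; apply/mem_set => m Fm.
rewrite sgvalD mcoeffD v0 // addr0 sgvalM; apply: mcoeffM_eq0 => x y mE.
have [px|px] := eqVneq (sgring_val p)@_x 0; [by left | right].
have [//|uy] := eqVneq (sgring_val u)@_y 0; apply: u0.
by move: Fm; rewrite mE FD => [[]||] //; [exact: sgring_supp px | exact: sgring_supp uy].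
Qed.

(* Modulo the ideal, an element is determined by its part supported on the face,
   and these parts live in the domain [{mpoly K[d]}]. *)
Lemma face_ideal_prime F : is_face F -> prime_ideal (face_ideal F).
Proof.
move=> faceF; split; first exact: face_ideal_closed.
case: faceF => F0 FD u v /set_mem uv0.
pose tr (p : A) : {mpoly K[d]} :=
  \sum_(m <- msupp (sgring_val p) | `[< F m >]) (sgring_val p)@_m *: 'X_[m].
have trE p m : (tr p)@_m = if `[< F m >] then (sgring_val p)@_m else 0.
  rewrite /tr raddf_sum /=.
  rewrite (eq_bigr (fun x => (sgring_val p)@_x * (x == m)%:R)); last first.
    by move=> x _; rewrite mcoeffZ mcoeffX.
  have [mp|mp] := boolP (m \in msupp (sgring_val p)); last first.
    rewrite (memN_msupp_eq0 mp) if_same big_seq_cond big1 // => x /andP[xp _].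
    by case: eqP xp mp => [-> ->|] //; rewrite mulr0.
  rewrite big_mkcond (bigD1_seq m) ?msupp_uniq //= big1 ?addr0 => [|x /negPf->].
    by rewrite eqxx mulr1.
  by rewrite mulr0 if_same.
have tr0 : tr u * tr v = 0.
  apply/mpolyP => m; rewrite mcoeff0.
  have [Fm|Fm] := pselect (F m).
    (* At an exponent of the face the two correction terms vanish: terms of [u] and [v] whose
       product has exponent in [F] both have exponents in [F]. *)
    have -> : tr u * tr v =
        sgring_val (u * v) - (sgring_val u - tr u) * sgring_val v - tr u * (sgring_val v - tr v).
      by rewrite sgvalM mulrBl subKr mulrBr subKr.
    have E x y : m = (x + y)%MM -> (sgring_val u)@_x != 0 -> (sgring_val v)@_y != 0 -> F x /\ F y.
      by move=> mE ux vy; apply/FD;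
        [exact: sgring_supp ux|exact: sgring_supp vy|rewrite -mE].
    rewrite !mcoeffB uv0 // !mcoeffM_eq0 ?subrr // => x y mE; last first.
      have [vy|vy] := eqVneq (sgring_val v)@_y 0; first by right.
      left; rewrite mcoeffB trE; have [ux|ux] := eqVneq (sgring_val u)@_x 0.
        by rewrite ux if_same subrr.
      by have [Fx _] := E _ _ mE ux vy; rewrite asboolT // subrr.
    have [ux|ux] := eqVneq (sgring_val u)@_x 0; first by left; rewrite trE ux if_same.
    right; rewrite mcoeffB trE; have [vy|vy] := eqVneq (sgring_val v)@_y 0.
      by rewrite vy if_same subrr.
    by have [_ Fy] := E _ _ mE ux vy; rewrite asboolT // subrr.
  apply: mcoeffM_eq0 => x y mE; rewrite !trE.
  have [ux|ux] := eqVneq (sgring_val u)@_x 0; first by left; rewrite ux if_same.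
  have [vy|vy] := eqVneq (sgring_val v)@_y 0; first by right; rewrite vy if_same.
  case: asboolP => Fx; [right|by left]; case: asboolP => // Fy; case: Fm.
  by rewrite mE; apply/FD => //; [exact: sgring_supp ux | exact: sgring_supp vy].
have trF p : tr p = 0 -> p \in face_ideal F.
  by move=> /mpolyP p0; apply/mem_set => m Fm; move: (p0 m); rewrite trE asboolT // mcoeff0.
by move/eqP: tr0; rewrite mulf_eq0 => /orP[] /eqP /trF ->; rewrite ?orbT.
Qed.

Lemma is_face0 : is_face [set 0%MM].
Proof.
split=> // x y _ _; split=> [/eqP|[-> ->]]; last by rewrite /= addm0.
by rewrite mnmD_eq0 => /andP[/eqP-> /eqP->].
Qed.

(** An element of a larger ideal with nonzero constant term would put that constant, a unit, in the
    ideal. *)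
Lemma irrelevant_maximal : maximal_ideal (face_ideal [set 0%MM]).
Proof.
split=> [|Q [Q0 Q1 QD] sQ]; first exact/face_ideal_closed/is_face0.
apply/seteqP; split=> // p Qp _ ->; apply/eqP; apply: contraT => p0; case/negP: Q1.
pose c := (sgring_val p)@_0; have c0 : c != 0 by [].
have Qc : sgconst c \in Q.
  rewrite -[sgconst c](addrNK p) addrC -[p]mul1r; apply: QD; first exact/mem_set.
  apply/mem_set/sQ => _ ->; rewrite mul1r sgvalB mcoeffB sgconstE mcoeffC.
  by rewrite eqxx mulr1 subrr.
have -> : 1 = sgconst c^-1 * sgconst c + 0.
  rewrite addr0; apply: sgval_inj; rewrite sgvalM sgval1 !sgconstE.
  by rewrite -mpolyCM mulVf.
exact: QD.
Qed.

End SemigroupRing.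

Arguments face_ideal K {d} S F _.

(** * Coordinates along the extremal rays *)

Section MnmRow.

Variables (F : nzRingType) (d : nat).
Implicit Types x y : 'X_{1..d}.

Lemma mnm_row0 : mnm_row F (0%MM : 'X_{1..d}) = 0.
Proof. by apply/rowP => i; rewrite !mxE mnm0E. Qed.

Lemma mnm_rowD x y : mnm_row F (x + y)%MM = mnm_row F x + mnm_row F y.
Proof. by apply/rowP => i; rewrite !mxE mnmDE natrD. Qed.

Lemma mnm_rowMn x n : mnm_row F (x *+ n)%MM = n%:R *: mnm_row F x.
Proof. by apply/rowP => i; rewrite !mxE mulmnE mulnC natrM. Qed.

Lemma mnm_row_sum (I : finType) (x : I -> 'X_{1..d}) :
  mnm_row F (\sum_i x i)%MM = \sum_i mnm_row F (x i).
Proof. exact: (big_morph _ mnm_rowD mnm_row0). Qed.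

End MnmRow.

Lemma mnm_row_inj (F : numDomainType) d : injective (@mnm_row F d).
Proof.
move=> x y /rowP xy; apply/mnmP => i.
by apply/eqP; rewrite -(eqr_nat F); move: (xy i); rewrite !mxE => ->.
Qed.

Lemma map_mnm_row (F F' : nzRingType) (f : {rmorphism F -> F'}) d (x : 'X_{1..d}) :
  map_mx f (mnm_row F x) = mnm_row F' x.
Proof. by apply/rowP => i; rewrite !mxE rmorph_nat. Qed.

(** * Nonnegative rational combinations, with denominators cleared *)

Section RationalCone.

Variable d : nat.
Implicit Types (a e : 'I_d -> 'X_{1..d}) (x y : 'X_{1..d}).

Definition rat_cone a : set 'X_{1..d} :=
  [set x | exists n (c : 'I_d -> nat),
     (0 < n)%N /\ (x *+ n = \sum_(i < d) a i *+ c i)%MM].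

Lemma rat_coneD a x y : rat_cone a x -> rat_cone a y -> rat_cone a (x + y)%MM.
Proof.
move=> [n [c [n0 xn]]] [m [b [m0 ym]]].
exists (n * m)%N, (fun i => c i * m + b i * n)%N; split; first by rewrite muln_gt0 n0.
apply/mnmP => k; rewrite mulmnE mnmDE mnm_sumE.
have /mnmP/(_ k) := xn; have /mnmP/(_ k) := ym; rewrite !mulmnE !mnm_sumE => yk xk.
rewrite mulnDl mulnA xk mulnCA (mulnC n) yk !big_distrl -big_split /=.
by apply: eq_bigr => i _; rewrite !mulmnE; lia.
Qed.

Lemma rat_cone_sum a (I : finType) (x : I -> 'X_{1..d}) :
  (forall i, rat_cone a (x i)) -> rat_cone a (\sum_i x i)%MM.
Proof.
move=> ax; apply: (big_ind (rat_cone a)) => //; last exact: rat_coneD.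
exists 1%N, (fun=> 0%N); split=> //; apply/mnmP => k.
by rewrite mulm1n mnm0E mnm_sumE big1 // => i _; rewrite mulm0n mnm0E.
Qed.

Lemma rat_cone_gen a i p : rat_cone a (a i *+ p)%MM.
Proof.
exists 1%N, (fun j => if j == i then p else 0%N); split=> //.
rewrite mulm1n (bigD1 i) //= eqxx big1 ?addm0 // => j /negPf ->.
exact: mulm0n.
Qed.

Lemma rat_coneMn a x n : rat_cone a x -> rat_cone a (x *+ n)%MM.
Proof.
move=> [m [c [m0 E]]]; exists m, (fun i => c i * n)%N; split=> //.
apply/mnmP => k; rewrite !mulmnE mulnAC mnm_sumE -mulmnE E mnm_sumE big_distrl.
by apply: eq_bigr => i _; rewrite !mulmnE mulnA.
Qed.

Lemma rat_cone_root a x n : (0 < n)%N -> rat_cone a (x *+ n)%MM -> rat_cone a x.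
Proof.
move=> n0 [m [c [m0 E]]]; exists (n * m)%N, c; split; first by rewrite muln_gt0 n0.
by rewrite -E; apply/mnmP => k; rewrite !mulmnE mulnA.
Qed.

End RationalCone.

Section Coordinates.

Variables (R : realType) (d : nat) (S : affine_semigroup d).
Implicit Types (a e : 'I_d -> 'X_{1..d}) (x y : 'rV[R]_d).

Definition gen_mx a : 'M[R]_d := \matrix_i mnm_row R (a i).

Definition gen_coord a i x : R := (x *m invmx (gen_mx a)) 0 i.

Lemma gen_coordD a i x y : gen_coord a i (x + y) = gen_coord a i x + gen_coord a i y.
Proof. by rewrite /gen_coord mulmxDl mxE. Qed.

Lemma gen_coordZ a i t x : gen_coord a i (t *: x) = t * gen_coord a i x.
Proof. by rewrite /gen_coord -scalemxAl mxE. Qed.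

Lemma gen_coord0 a i : gen_coord a i 0 = 0.
Proof. by rewrite /gen_coord mul0mx mxE. Qed.

Lemma gen_coordB a i x y : gen_coord a i (x - y) = gen_coord a i x - gen_coord a i y.
Proof. by rewrite gen_coordD -scaleN1r gen_coordZ mulN1r. Qed.

Lemma gen_coord_sum a i (I : finType) (x : I -> 'rV[R]_d) :
  gen_coord a i (\sum_j x j) = \sum_j gen_coord a i (x j).
Proof. exact: (big_morph _ (gen_coordD a i) (gen_coord0 a i)). Qed.

(** These properties are shared by the generators given by [simplicial] and by the extremal rays;
    the coordinate lemmas serve first for the former, then for the latter. *)
Definition simplicial_gens a :=
  [/\ forall i, asg_set S (a i), gen_mx a \in unitmx & asg_set S `<=` rat_cone a].

Section Gens.

Variable a : 'I_d -> 'X_{1..d}.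
Hypothesis ga : simplicial_gens a.

Lemma gen_coord_gen i j : gen_coord a i (mnm_row R (a j)) = (j == i)%:R.
Proof.
have [_ ua _] := ga; rewrite /gen_coord.
have -> : mnm_row R (a j) = row j (gen_mx a) by rewrite rowK.
by rewrite -row_mul mulmxV // !mxE.
Qed.

Lemma gen_coordK x : x = \sum_i gen_coord a i x *: mnm_row R (a i).
Proof.
have [_ ua _] := ga; rewrite -{1}(mulmxKV ua x) mulmx_sum_row.
by apply: eq_bigr => i _; rewrite rowK.
Qed.

Lemma gen_coord_inj x y : (forall i, gen_coord a i x = gen_coord a i y) -> x = y.
Proof.
by move=> xy; rewrite (gen_coordK x) (gen_coordK y); apply: eq_bigr => i _; rewrite xy.
Qed.

Lemma gen_coord_comb i (t : 'I_d -> R) :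
  gen_coord a i (\sum_j t j *: mnm_row R (a j)) = t i.
Proof.
rewrite gen_coord_sum (bigD1 i) //= gen_coordZ gen_coord_gen eqxx mulr1.
rewrite big1 ?addr0 // => j /negPf ji.
by rewrite gen_coordZ gen_coord_gen ji mulr0.
Qed.

Lemma gen_coord_ge0 i (m : 'X_{1..d}) : asg_set S m -> 0 <= gen_coord a i (mnm_row R m).
Proof.
have [_ _ rS] := ga; move=> /rS[n [c [n0 E]]].
have /(congr1 (gen_coord a i \o mnm_row R)) /= := E.
rewrite mnm_rowMn mnm_row_sum gen_coordZ.
rewrite (eq_bigr (fun j => (c j)%:R *: mnm_row R (a j))) => [|j _]; last first.
  exact: mnm_rowMn.
rewrite gen_coord_comb => ci.
have : 0 <= n%:R * gen_coord a i (mnm_row R m) by rewrite ci ler0n.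
by rewrite pmulr_rge0 // ltr0n.
Qed.

Lemma coneP x : cone S x <-> forall i, 0 <= gen_coord a i x.
Proof.
have [Sa _ _] := ga; split=> [[n [m [t [Sm t0 ->]]]] i|x0].
  rewrite gen_coord_sum sumr_ge0 // => j _.
  by rewrite gen_coordZ mulr_ge0 // gen_coord_ge0.
by exists d, a, (fun i => gen_coord a i x); split=> //; apply: gen_coordK.
Qed.

Lemma gen_neq0 i : a i != 0%MM.
Proof.
apply/eqP => ai0; have := gen_coord_gen i i.
by rewrite ai0 mnm_row0 gen_coord0 eqxx => /eqP; rewrite eq_sym oner_eq0.
Qed.

Lemma gen_coord_eq0 (m : 'X_{1..d}) :
  (forall i, gen_coord a i (mnm_row R m) = 0) -> m = 0%MM.
Proof.
move=> m0; apply: (@mnm_row_inj R); apply: gen_coord_inj => i.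
by rewrite m0 mnm_row0 gen_coord0.
Qed.

(* The ray through [m] is a face, so it contains each summand
   [gen_coord a i m *: a i] of [m]. *)
Lemma extremal_ray_gen (m : 'X_{1..d}) : extremal_ray R S m ->
  exists i t, 0 < t /\ mnm_row R m = t *: mnm_row R (a i).
Proof.
move=> [Sm [Cm m0 face] _].
have [i mi] : exists i, gen_coord a i (mnm_row R m) != 0.
  apply: contrapT => /forallNP all0; case/negP: m0; apply/eqP.
  apply: gen_coord_inj => i; rewrite gen_coord0; apply/eqP.
  by apply: contraT => mi; case: (all0 i).
pose x := gen_coord a i (mnm_row R m) *: mnm_row R (a i).
have xE j : gen_coord a j x = gen_coord a j (mnm_row R m) * (i == j)%:R.
  rewrite gen_coordZ gen_coord_gen; case: eqP => [->//|_]; by rewrite !mulr0.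
have [|||[t /= t0 tE] _] := face x (mnm_row R m - x).
- apply/coneP => j; by rewrite xE mulr_ge0 ?ler0n ?gen_coord_ge0.
- apply/coneP => j; rewrite gen_coordB xE; case: eqP => _.
    by rewrite mulr1 subrr.
  by rewrite mulr0 subr0 gen_coord_ge0.
- by rewrite addrC subrK; exists 1; rewrite ?scale1r //= ler01.
exists i, (t^-1 * gen_coord a i (mnm_row R m)).
have tn0 : t != 0.
  apply: contra_neq mi => t00; have := xE i; rewrite -tE t00 scale0r gen_coord0.
  by rewrite eqxx mulr1.
split; last by rewrite -scalerA -/x -tE scalerA mulVf // scale1r.
by rewrite mulr_gt0 ?invr_gt0 // lt_def ?tn0 ?t0 ?mi ?gen_coord_ge0.
Qed.

End Gens.

Lemma simplicial_has_gens : simplicial S -> exists e, simplicial_gens e.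
Proof.
move=> [G [GS _] [e [Ge fe re]]]; exists e; split=> //.
  move=> i; rewrite -GS; exists [:: e i]; last by rewrite big_seq1.
  by move=> x /=; rewrite inE => /eqP ->.
rewrite -row_free_unit.
have -> : gen_mx e = map_mx (ratr : rat -> R) (\matrix_(i < d) mnm_row rat (e i)).
  by apply/matrixP => i j; rewrite !mxE ratr_nat.
by rewrite row_free_map.
Qed.

(** The real ratio [t] of two natural vectors is rational: for a nonzero entry [x k],
    cross-multiplication by [a i k] and [x k] gives equal vectors. *)
Lemma rat_cone_ray a i (x : 'X_{1..d}) (t : R) : 0 < t -> x != 0%MM ->
  mnm_row R (a i) = t *: mnm_row R x -> rat_cone a x.
Proof.
move=> t0 x0 E.
have El k : (a i k)%:R = t * (x k)%:R by move/rowP/(_ k): E; rewrite !mxE.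
have [k xk] : exists k, x k != 0%N.
  apply: contrapT => /forallNP all0; case/negP: x0; apply/eqP/mnmP => k.
  by rewrite mnm0E; apply/eqP; apply: contraT => xk; case: (all0 k).
have aik : (0 < a i k)%N.
  by rewrite -(ltr_nat R) El mulr_gt0 // ltr0n lt0n.
apply: (rat_cone_root aik).
suff -> : (x *+ a i k = a i *+ x k)%MM by apply: rat_cone_gen.
apply/mnmP => l; rewrite !mulmnE; apply/eqP; rewrite -(eqr_nat R) !natrM !El.
by apply/eqP; ring.
Qed.

(** Each [a i] lies on the ray of some [e (s i)]. Two of them on one ray are each below the other by
    minimality, so [s] is injective, hence bijective, and [a] is [e] permuted and rescaled. *)
Lemma extremal_rays_gens a : simplicial S -> extremal_rays R S a -> simplicial_gens a.
Proof.
move=> /simplicial_has_gens[e ge] [inj_a ra].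
have ext i : extremal_ray R S (a i) by have : range a (a i) by []; rewrite ra.
have /choice[s Hs] : forall i, exists j, exists t,
    0 < t /\ mnm_row R (a i) = t *: mnm_row R (e j).
  by move=> i; apply: extremal_ray_gen.
have inj_s : injective s.
  move=> i j sij; apply: inj_a.
  have le k l : s k = s l -> (a k <= a l)%MM.
    move=> skl; have [_ _] := ext k; apply.
    - by have [] := ext l.
    - by have [_ [_ + _] _] := ext l; apply: contra_neq => ->; apply: mnm_row0.
    - have [t [t0 ->]] := Hs k; have [u [u0 ->]] := Hs l; exists (u / t).
        by rewrite /= divr_ge0 ?ltW.
      by rewrite skl scalerA divfK // gt_eqF.
  apply/mnmP => k; apply/eqP; rewrite eqn_leq.
  by rewrite (mnm_lepP (le _ _ sij)) (mnm_lepP (le _ _ (esym sij))).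
have [s' sK s'K] := injF_bij inj_s.
have as' j : exists t, 0 < t /\ mnm_row R (a (s' j)) = t *: mnm_row R (e j).
  by have := Hs (s' j); rewrite s'K.
have [Se ue re] := ge; split.
- by move=> i; have [] := ext i.
- have /choice[t Ht] := as'.
  have E : gen_mx e = (\matrix_(j, k) ((t j)^-1 * (s' j == k)%:R)) *m gen_mx a.
    apply/row_matrixP => j; rewrite row_mul mulmx_sum_row (bigD1 (s' j)) //=.
    rewrite !rowK !mxE eqxx mulr1 big1 => [|k /negPf]; last first.
      by rewrite !mxE eq_sym => ->; rewrite mulr0 scale0r.
    have [tj ->] := Ht j; rewrite addr0 scalerA mulVf ?scale1r //.
    by rewrite gt_eqF.
  by move: ue; rewrite E unitmx_mul => /andP[].
move=> x Sx; have [n [c [n0 xn]]] := re x Sx; apply: (rat_cone_root n0).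
rewrite xn; apply: rat_cone_sum => j; apply: rat_coneMn.
have [t [t0 E]] := as' j; apply: (rat_cone_ray t0 _ E).
exact: gen_neq0 ge j.
Qed.

End Coordinates.

(** * The Cohen-Macaulay hypothesis *)

Section CohenMacaulayGens.

Variables (R : realType) (K : fieldType) (d : nat) (S : affine_semigroup d).
Variable a : 'I_d -> 'X_{1..d}.
Hypothesis ga : simplicial_gens R S a.
Local Notation A := (semigroup_ring K S).
Implicit Types (u v x m : 'X_{1..d}).

Definition coord_face k : set 'X_{1..d} :=
  [set m | forall i : 'I_d, (k <= i)%N -> gen_coord a i (mnm_row R m) = 0].

Lemma coord_face_is_face k : is_face S (coord_face k).
Proof.
split=> [i _|x y Sx Sy]; first by rewrite mnm_row0 gen_coord0.
split=> [xy|[Fx Fy] i ki]; last by rewrite mnm_rowD gen_coordD Fx // Fy // addr0.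
split=> i ki; have := xy i ki; rewrite mnm_rowD gen_coordD;
  have := gen_coord_ge0 ga i Sx; have := gen_coord_ge0 ga i Sy; lra.
Qed.

Lemma irrelevant_prime_chain : prime_chain (face_ideal K S [set 0%MM]) d.
Proof.
have [Sa _ _] := ga.
exists (fun k => face_ideal K S (coord_face (d - k))); split=> [i _|i ltid|].
- exact/face_ideal_prime/coord_face_is_face.
- have ltk : (d - i.+1 < d)%N by lia.
  split=> [p Qp m Fm|].
    by apply: Qp => j dij; apply: Fm; lia.
  move=> /(_ (sgmono K S (a (Ordinal ltk)))) QQ.
  have /QQ : face_ideal K S (coord_face (d - i.+1)) (sgmono K S (a (Ordinal ltk))).
    move=> m Fm; rewrite sgmonoE // mcoeffX; case: eqP => // am.
    have := Fm (Ordinal ltk) (leqnn _).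
    by rewrite -am (gen_coord_gen ga) eqxx => /eqP; rewrite oner_eq0.
  move/(_ (a (Ordinal ltk))); rewrite sgmonoE // mcoeffX eqxx => Q1.
  suff /Q1/eqP : coord_face (d - i) (a (Ordinal ltk)) by rewrite oner_eq0.
  move=> j dij; rewrite (gen_coord_gen ga) -val_eqE /=.
  by case: eqP => // dj; lia.
congr face_ideal; apply/seteqP; split=> [m Fm|_ -> i _].
  by apply: (gen_coord_eq0 ga) => i; apply: Fm; rewrite subnn.
by rewrite mnm_row0 gen_coord0.
Qed.

(** A nonzero exponent [m] has a multiple in which some [a i] occurs, so a power of its monomial is
    divisible by that of [a i *+ n i]. Arbitrary [n] is allowed because the exchange argument needs
    large exponents. *)
Lemma irrelevant_radical (n : 'I_d -> nat) (f : A) :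
  face_ideal K S [set 0%MM] f ->
  fam_radical (fun i => sgmono K S (a i *+ n i)%MM) f.
Proof.
move=> f0; have [Sa _ rS] := ga; rewrite (sgring_sum f) big_seq.
apply: (big_ind (fam_radical _)) => [||m]; first exact: fam_radical0.
  exact: fam_radicalD.
rewrite mcoeff_msupp => fm; have Sm := sgring_supp fm; apply: fam_radicalM.
have m0 : m != 0%MM by apply: contra_neq fm => ->; apply: f0.
have [k [c [k0 mk]]] := rS m Sm.
have [i ci] : exists i, (0 < c i)%N.
  apply: contrapT => /forallNP all0; case/negP: m0.
  rewrite -mdeg_eq0 -(eqn_pmul2r k0) mul0n -mdegMn mk mdeg_sum big1 // => i _.
  by rewrite mdegMn; have := all0 i; rewrite lt0n => /negP/negPn/eqP ->; rewrite muln0.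
exists (k * n i)%N; rewrite -sgmonoX //.
have -> : (m *+ (k * n i) = (\sum_(j < d) a j *+ (n i * (c j - (j == i))) + a i *+ n i))%MM.
  apply/mnmP => l; rewrite mnmDE mulmnE mulnA -mulmnE mk !mnm_sumE mulmnE.
  rewrite big_distrl /= (bigD1 i) // [in RHS](bigD1 i) //= eqxx mulmnE.
  rewrite [in RHS]addnAC mulmnE; congr (_ + _)%N; first by nia.
  by apply: eq_bigr => j /negPf ->; rewrite !mulmnE subn0; lia.
rewrite sgmonoD; last exact: asgMn.
  exact/fam_idealM/(fam_ideal_mem (fun i => sgmono K S (a i *+ n i)%MM)).
by apply: asg_sum => j; apply: asgMn.
Qed.

Hypothesis cmS : cohen_macaulay A.

(** The depth of the irrelevant ideal equals its height, which is at least [d] by the chain of face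
    primes. *)
Lemma cohen_macaulay_regular :
  exists s : seq A, [/\ (d <= size s)%N, regular_seq s
    & forall f, f \in s -> face_ideal K S [set 0%MM] f].
Proof.
have [_ /(_ _ (irrelevant_maximal K S))[n [[_ cn] [[s [sn sP rs]] _]]]] := cmS.
exists s; split=> //; first by rewrite sn; apply/cn/irrelevant_prime_chain.
Qed.

(* Otherwise [x^u * x^(a j) = x^v * x^(a i)] would be a nontrivial relation among
   the [x^(e l)], i.e. a nonzero Koszul class of degree [d - 1]. *)
Lemma cohen_macaulay_exchange i j u v : i != j ->
  asg_set S u -> asg_set S v -> (u + a j = v + a i)%MM ->
  exists2 x, asg_set S x & u = (x + a i)%MM.
Proof.
move=> ij Su Sv uv; have [Sa _ _] := ga.
(* For [l] other than [i] and [j], the degree of [e l] exceeds that of [u], so [e l] cannot be a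
   summand of [u]. *)
pose n l := if (l == i) || (l == j) then 1%N else (mdeg u).+1.
pose e l := (a l *+ n l)%MM; pose y l := sgmono K S (e l).
have Se l : asg_set S (e l) by apply: asgMn.
have [s [ds rs sm]] := cohen_macaulay_regular.
have d0 : (0 < d)%N by exact: leq_ltn_trans (leq0n i) (ltn_ord i).
pose sg l : A := ksign A l [set: 'I_d]%SET.
(* The signs make the single top component of [kdiff c] equal to the difference of the two sides of
   the monomial relation, which is 0. *)
pose c (F : {set 'I_d}) : A :=
  if F == [set~ j]%SET then sg j * sgmono K S u else
  if F == [set~ i]%SET then - (sg i * sgmono K S v) else 0.
have setCinj k l : ([set~ k]%SET == [set~ l]%SET :> {set 'I_d}) = (k == l).
  by rewrite (inj_eq (can_inj (@finset.setCK _))) (inj_eq finset.set1_inj).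
have cE l : c [set~ l]%SET = if l == j then sg j * sgmono K S u else
    if l == i then - (sg i * sgmono K S v) else 0.
  by rewrite /c !setCinj.
have cc : kcocycle y (take 0 s) d.-1 c.
  move=> F; rewrite prednK // => cF.
  have -> : F = [set: 'I_d]%SET.
    by apply/eqP; rewrite eqEcard finset.subsetT cardsT card_ord cF /=.
  rewrite /kdiff (eq_bigr (fun l => sg l * (y l * c [set~ l]%SET))); last first.
    by move=> l _; rewrite finset.setTD.
  rewrite (bigD1 j) ?inE //= (bigD1 i) ?inE //= big1 => [|l /andP[/andP[_ lj] li]].
    rewrite !cE !eqxx (negPf ij) addr0 mulrN mulrN.
    have E l (p : A) : sg l * (y l * (sg l * p)) = y l * p.
      by rewrite mulrCA (mulrA (sg l)) ksign_sqr mul1r.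
    rewrite !E /y /e /n eqxx orbT eqxx !mulm1n -!sgmonoD // addmC uv addmC subrr.
    exact: ideal_gen0.
  by rewrite cE (negPf li) (negPf lj) !mulr0.
have rad f : f \in s -> fam_radical y f.
  by move=> /sm; apply: irrelevant_radical.
have [|b Hb] := koszul_acyclic rs rad _ cc; first by rewrite addn0 prednK.
(* The ideal of the empty sequence is zero, so the monomial of [u] is, up to sign, exactly a
   combination of the [y l] with [l] different from [j]; one of these must contribute at [u]. *)
have := Hb [set~ j]%SET; rewrite cardsC1 card_ord take0 => /(_ erefl) [r].
rewrite big_ord0 cE eqxx => /eqP; rewrite subr_eq0 => /eqP bE.
have : (sgring_val (sgmono K S u))@_u != 0 by rewrite sgmonoE // mcoeffX eqxx oner_eq0.
rewrite -[sgmono K S u]mul1r -(ksign_sqr A j [set: 'I_d]%SET) -mulrA bE.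
rewrite /kdiff mulr_sumr sgval_sum raddf_sum /=.
have [all0|] := pselect (forall l, l \in [set~ j]%SET ->
  (sgring_val (sg j * (ksign A l [set~ j]%SET * (y l * b ([set~ j]%SET :\ l)%SET))))@_u = 0).
  by rewrite big1 ?eqxx.
move=> /existsNP[l /not_implyP[lj ul]] _.
have {ul} [q ul] : exists q : A, (sgring_val (y l * q))@_u <> 0.
  have E (p q z t : A) : p * (q * (z * t)) = z * (p * q * t).
    by rewrite (mulrCA q) (mulrCA p) (mulrA p).
  by rewrite E in ul; eexists; exact: ul.
have [x Sx uE] : exists2 x, asg_set S x & u = (e l + x)%MM.
  apply: contrapT => nx; apply: ul; rewrite sgvalM; apply: mcoeffM_eq0 => z x uE.
  rewrite sgmonoE // mcoeffX; case: eqP => [ez|]; last by left.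
  right; apply/eqP; apply: contraT => /sgring_supp Sx; case: nx; exists x => //.
  by rewrite uE ez.
have [li|li] := eqVneq l i.
  by exists x => //; rewrite uE li /e /n eqxx mulm1n addmC.
have /(congr1 mdeg) := uE; rewrite /e /n (negPf li).
move: lj; rewrite !inE => /negPf ->; rewrite mdegD mdegMn.
have := gen_neq0 ga l; rewrite -mdeg_eq0; nia.
Qed.

End CohenMacaulayGens.

(** * Apery elements and the conductor *)

Section Apery.

Variables (R : realType) (d : nat) (S : affine_semigroup d).
Variable a : 'I_d -> 'X_{1..d}.
Hypothesis ga : simplicial_gens R S a.
Implicit Types (u v w x y b : 'X_{1..d}) (g h : 'rV[int]_d) (z : 'I_d -> int).
Implicit Types (n : 'I_d -> nat) (i j k : 'I_d).
Local Notation zS := (zsemigroup S).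
Local Notation r := (mnm_row int).

Definition zcomb z : 'rV[int]_d := \sum_i z i *: r (a i).

Definition zcoord i g : R := gen_coord a i (map_mx intr g).

Lemma zcombD z z' : zcomb (fun i => z i + z' i) = zcomb z + zcomb z'.
Proof. by rewrite -big_split; apply: eq_bigr => i _; rewrite scalerDl. Qed.

Lemma zcombN z : zcomb (fun i => - z i) = - zcomb z.
Proof. by rewrite /zcomb -sumrN; apply: eq_bigr => i _; rewrite scaleNr. Qed.

Lemma zcombB z z' : zcomb (fun i => z i - z' i) = zcomb z - zcomb z'.
Proof. by rewrite zcombD zcombN. Qed.

Lemma zcomb_nat n : zcomb (fun i => (n i)%:Z) = r (\sum_i a i *+ n i)%MM.
Proof.
by rewrite mnm_row_sum; apply: eq_bigr => i _; rewrite mnm_rowMn natz.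
Qed.

Lemma zcomb_gen i : zcomb (fun j => (j == i)%:Z) = r (a i).
Proof.
rewrite /zcomb (bigD1 i) //= eqxx scale1r big1 ?addr0 // => j /negPf ->.
by rewrite scale0r.
Qed.

Lemma zcomb_pred n i : (0 < n i)%N ->
  zcomb (fun j => (n j)%:Z) = zcomb (fun j => (n j - (j == i))%N%:Z) + r (a i).
Proof.
move=> ni; rewrite -(zcomb_gen i) -zcombD; apply: eq_bigr => j _; congr (_ *: _).
by case: eqP => [->|_] /=; lia.
Qed.

Lemma zcomb0 n : (forall i, n i = 0%N) -> zcomb (fun j => (n j)%:Z) = 0.
Proof. by move=> n0; rewrite /zcomb big1 // => i _; rewrite n0 scale0r. Qed.

(** The disjoint supports of the positive and negative parts are what [zsg_disjoint] requires. *)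
Lemma zcomb_posneg z : exists n m : 'I_d -> nat,
  [/\ forall i, z i = (n i)%:Z - (m i)%:Z, forall i, n i = 0%N \/ m i = 0%N
    & zcomb z = zcomb (fun i => (n i)%:Z) - zcomb (fun i => (m i)%:Z)].
Proof.
pose n i := if 0 <= z i then `|z i|%N else 0%N.
pose m i := if 0 <= z i then 0%N else `|z i|%N.
have zE i : z i = (n i)%:Z - (m i)%:Z.
  by rewrite /n /m; case: ifP; lia.
exists n, m; split=> // [i|]; first by rewrite /n /m; case: ifP; [right|left].
by rewrite -zcombB; apply: eq_bigr => i _; rewrite {1}zE.
Qed.

Lemma zcoordD i g h : zcoord i (g + h) = zcoord i g + zcoord i h.
Proof. by rewrite /zcoord map_mxD gen_coordD. Qed.

Lemma zcoordB i g h : zcoord i (g - h) = zcoord i g - zcoord i h.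
Proof. by rewrite /zcoord map_mxB gen_coordB. Qed.

Lemma zcoord_mnm i x : zcoord i (r x) = gen_coord a i (mnm_row R x).
Proof. by rewrite /zcoord map_mnm_row. Qed.

Lemma zcoord_comb i z : zcoord i (zcomb z) = (z i)%:~R.
Proof.
rewrite -[RHS](gen_coord_comb ga i (fun j => (z j)%:~R)) /zcoord; congr gen_coord.
by rewrite map_mx_sum; apply: eq_bigr => j _; rewrite map_mxZ map_mnm_row.
Qed.

Lemma zcomb_inj z z' : zcomb z = zcomb z' -> z =1 z'.
Proof.
move=> zz' i; have /(congr1 (zcoord i)) := zz'; rewrite !zcoord_comb.
exact: intr_inj.
Qed.

Lemma zsg0 : zS 0.
Proof. by exists 0%MM; [apply: asg0 | apply: mnm_row0]. Qed.

Lemma zsgD g h : zS g -> zS h -> zS (g + h).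
Proof.
move=> [x Sx <-] [y Sy <-]; exists (x + y)%MM; [exact: asgD | exact: mnm_rowD].
Qed.

Lemma zsg_mnm x : asg_set S x -> zS (r x).
Proof. by move=> Sx; exists x. Qed.

Lemma zsg_gen i : zS (r (a i)).
Proof. by have [Sa _ _] := ga; apply: zsg_mnm. Qed.

Lemma zsg_comb n : zS (zcomb (fun i => (n i)%:Z)).
Proof.
have [Sa _ _] := ga; rewrite zcomb_nat; apply: zsg_mnm.
by apply: asg_sum => i; apply: asgMn.
Qed.

Lemma sgroupB g h : sgroup S g -> sgroup S h -> sgroup S (g - h).
Proof.
move=> [x Sx [y Sy <-]] [x' Sx' [y' Sy' <-]].
exists (x + y'); first exact: zsgD.
by exists (y + x'); [exact: zsgD | rewrite opprD opprB addrACA].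
Qed.

Lemma zsg_sgroup g : zS g -> sgroup S g.
Proof.
by move=> Sg; exists g => //; exists 0; [exact: zsg0 | rewrite subr0].
Qed.

Lemma sgroupD g h : sgroup S g -> sgroup S h -> sgroup S (g + h).
Proof.
move=> Gg Gh; rewrite -[h]opprK; apply: sgroupB => //.
by rewrite -sub0r; apply: sgroupB => //; apply/zsg_sgroup/zsg0.
Qed.

Lemma sgroup_comb z : sgroup S (zcomb z).
Proof.
have [n [m [_ _ ->]]] := zcomb_posneg z.
by apply: sgroupB; apply/zsg_sgroup/zsg_comb.
Qed.

Lemma normalizationP g :
  normalization R S g <-> sgroup S g /\ forall i, 0 <= zcoord i g.
Proof. by split=> -[Gg /(coneP ga)]. Qed.

Lemma cone_leP x y :
  cone_le R S x y <-> forall i, zcoord i (r x) <= zcoord i (r y).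
Proof.
rewrite /cone_le (coneP ga); split=> xy i; have := xy i;
  by rewrite gen_coordB subr_ge0 !zcoord_mnm.
Qed.

Lemma cone_row_ge0 (x : 'rV[R]_d) k : cone S x -> 0 <= x 0 k.
Proof.
move=> [n [m [t [_ t0 ->]]]]; rewrite summxE sumr_ge0 // => i _.
by rewrite !mxE mulr_ge0.
Qed.

Lemma cone_le_mdeg x y : cone_le R S x y -> x <> y -> (mdeg x < mdeg y)%N.
Proof.
move=> xy nxy; have le k : (x k <= y k)%N.
  by have := cone_row_ge0 k xy; rewrite !mxE subr_ge0 ler_nat.
rewrite ltn_neqAle; apply/andP; split; last first.
  by rewrite !mdegE; apply: leq_sum => k _.
apply: contra_notN nxy => /eqP xyE.
have yE : (y - x + x)%MM = y by apply: submK; apply/mnm_lepP.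
move: xyE; rewrite -yE mdegD -{1}[mdeg x]add0n => /addIn /esym/eqP.
by rewrite mdeg_eq0 => /eqP ->; rewrite add0m.
Qed.

(** Degree grows strictly along [cone_le], so climbing inside a set of bounded degree stops. *)
Lemma cone_max_above (X : set 'X_{1..d}) N x :
  (forall y, X y -> (mdeg y <= N)%N) -> X x ->
  exists2 y, cone_max R S X y & cone_le R S x y.
Proof.
move=> XN; have [k] := ubnP (N - mdeg x); elim: k x => // k IHk x Nx Xx.
have [mx|nmx] := pselect (cone_max R S X x).
  by exists x => //; apply/cone_leP => i.
have [y [Xy xy nxy]] : exists y, [/\ X y, cone_le R S x y & y <> x].
  apply: contrapT => nex; apply: nmx; split=> // y Xy xy.
  by apply: contrapT => nxy; apply: nex; exists y.
have ltxy := cone_le_mdeg xy (nesym nxy).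
have [|t mt yt] := IHk y _ Xy; first by have := XN _ Xy; lia.
exists t => //; apply/cone_leP => i.
by move/cone_leP/(_ i): xy => /le_trans; apply; move/cone_leP: yt.
Qed.

Lemma apery_zsg v : apery S a v -> zS (r v).
Proof. by case=> Sv _; apply: zsg_mnm. Qed.

Lemma apery_decomp g : zS g ->
  exists v n, apery S a v /\ g = r v + zcomb (fun i => (n i)%:Z).
Proof.
move=> [x Sx <-] {g}; have [k] := ubnP (mdeg x); elim: k x Sx => // k IHk x Sx ltk.
have [Ax|nAx] := pselect (apery S a x).
  by exists x, (fun=> 0%N); split=> //; rewrite zcomb0 ?addr0.
have [i [y Sy /esym/eqP]] : exists i, zS (r x - r (a i)).
  apply: contrapT => nex; apply: nAx; split=> // i ai; apply: nex; by exists i.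
rewrite subr_eq -mnm_rowD => /eqP/(@mnm_row_inj int) xE.
have [|v [n [Av yE]]] := IHk y Sy.
  have := gen_neq0 ga i; move: ltk; rewrite xE mdegD -mdeg_eq0; lia.
exists v, (fun j => n j + (j == i))%N; split=> //.
by rewrite xE mnm_rowD yE -addrA -(zcomb_gen i) -zcombD.
Qed.

Lemma sgroup_decomp g : sgroup S g -> exists v z, apery S a v /\ g = r v + zcomb z.
Proof.
move=> [_ [x Sx <-] [_ [y Sy <-] <-]]; have [_ _ rS] := ga.
have [[|n] [c [n0 yn]]] := rS y Sy; first by [].
(* Write [x - y] as [x + n y] minus [(n + 1) y], where the latter is a combination of the [a i]. *)
have [v [m [Av E]]] := apery_decomp (zsg_mnm (asgD Sx (asgMn n Sy))).
exists v, (fun i => (m i)%:Z - (c i)%:Z); split=> //.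
rewrite zcombB addrA -E zcomb_nat -yn mulmS !mnm_rowD.
by rewrite opprD addrA addrAC addrK.
Qed.

Lemma fractional_part g : exists z, forall i, 0 <= zcoord i (g + zcomb z) < 1.
Proof.
exists (fun i => - Num.floor (zcoord i g)) => i.
have := floor_itv (zcoord i g); rewrite zcoordD zcoord_comb rmorphN rmorphD /=.
by move=> /andP[? ?]; apply/andP; split; lra.
Qed.

Lemma zcoord_ge0_mnm g : (forall i, 0 <= zcoord i g) -> exists x, g = r x.
Proof.
move=> g0; have Cg : cone S (map_mx intr g : 'rV[R]_d) by apply/(coneP ga).
exists [multinom `|g 0%R k|%N | k < d]; apply/rowP => k; rewrite mxE mnmE.
have := cone_row_ge0 k Cg; rewrite mxE ler0z => gk.
by rewrite natz gez0_abs.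
Qed.

Lemma apery_remainder v z : apery S a v ->
  (forall i, 0 <= zcoord i (r v + zcomb z) < 1) ->
  exists2 b, r v + zcomb z = r b & is_remainder R a v b.
Proof.
move=> [Sv _] g01.
have [|b bE] := @zcoord_ge0_mnm (r v + zcomb z).
  by move=> i; have /andP[] := g01 i.
exists b => //; split.
  exists (fun i => zcoord i (r b)); first by move=> i; rewrite -bE.
  rewrite [LHS](gen_coordK ga); apply: eq_bigr => i _; by rewrite zcoord_mnm.
(* The coordinates of [v] are nonnegative and the shifted ones are below 1, so the integer [z i] is
   below 1. *)
have z0 i : z i <= 0.
  have := gen_coord_ge0 ga i Sv; have /andP[_] := g01 i.
  rewrite zcoordD zcoord_comb zcoord_mnm => h1 h2.
  by rewrite -ltzD1 -(ltr_int R) add0r; lra.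
exists (fun i => `|z i|%N); apply: (@mnm_row_inj int).
rewrite mnm_rowD -bE -zcomb_nat addrCA -[LHS]addr0; congr (_ + _).
rewrite -zcombD /zcomb big1 // => i _.
by rewrite [_ + _](_ : _ = 0) ?scale0r //; have := z0 i; lia.
Qed.

Lemma remainderP v b : is_remainder R a v b ->
  (forall i, 0 <= zcoord i (r b) < 1) /\ exists z, r b = r v + zcomb z.
Proof.
move=> [[l l01 bE] [n vE]]; split=> [i|].
  by rewrite zcoord_mnm bE (gen_coord_comb ga).
exists (fun i => - (n i)%:Z); rewrite zcombN zcomb_nat vE mnm_rowD.
by rewrite addrAC subrr add0r.
Qed.

(** This bound does not depend on [v]: it leaves finitely many remainders and ensures maximal ones
    exist. *)
Lemma remainder_mdeg v b : is_remainder R a v b ->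
  (mdeg b <= mdeg (\sum_i a i)%MM)%N.
Proof.
move=> [[l l01 /rowP bE] _]; rewrite !mdegE; apply: leq_sum => k _.
rewrite mnm_sumE -(ler_nat R); have := bE k; rewrite !mxE => ->.
rewrite summxE natr_sum; apply: ler_sum => i _; rewrite !mxE.
by rewrite ler_piMl //; have /andP[_ /ltW] := l01 i.
Qed.

(** * Apery elements as representatives of group(S) modulo the lattice of the rays *)

Section Exchange.

Hypothesis exchange : forall i j u v, i != j -> asg_set S u -> asg_set S v ->
  (u + a j = v + a i)%MM -> exists2 x, asg_set S x & u = (x + a i)%MM.

Lemma zsg_exchange i j g : i != j -> zS (g + r (a i)) -> zS (g + r (a j)) -> zS g.
Proof.
move=> ij [u Su uE] [v Sv vE].
have [|x Sx ux] := @exchange i j u v ij Su Sv.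
  by apply: (@mnm_row_inj int); rewrite !mnm_rowD uE vE addrAC.
exists x => //; apply: (addIr (r (a i))); by rewrite -uE ux mnm_rowD.
Qed.

(** Induction on the total size: remove [a i] from the first combination and [a j] from the second,
    with [i] different from [j]. The induction hypothesis puts [g + a i] and [g + a j] in [S], and
    the exchange property applies. *)
Lemma zsg_disjoint (n m : 'I_d -> nat) g : (forall i, n i = 0%N \/ m i = 0%N) ->
  zS (g + zcomb (fun i => (n i)%:Z)) -> zS (g + zcomb (fun i => (m i)%:Z)) -> zS g.
Proof.
have [N] := ubnP (\sum_i n i + \sum_i m i)%N; 
elim: N n m g => // N IHN n m g; rewrite ltnS => ltN dis Sn Sm.
have zero (p : 'I_d -> nat) : (forall i, ~ (0 < p i)%N) -> forall i, p i = 0%N.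
  by move=> p0 i; have := p0 i; lia.
have [[i ni]|/forallNP/zero n0] := pselect (exists i, (0 < n i)%N); last first.
  by move: Sn; rewrite zcomb0 ?addr0.
have [[j mj]|/forallNP/zero m0] := pselect (exists i, (0 < m i)%N); last first.
  by move: Sm; rewrite zcomb0 ?addr0.
have sum_pred (p : 'I_d -> nat) k : (0 < p k)%N ->
    (\sum_l (p l - (l == k)) < \sum_l p l)%N.
  move=> pk; rewrite (bigD1 k) //= [in X in (_ < X)%N](bigD1 k) //= eqxx.
  rewrite -addSn leq_add ?subn1 ?prednK //.
  by apply: leq_sum => l _; rewrite leq_subr.
have ij : i != j by apply: contraTneq ni => ->; case: (dis j); lia.
apply: (zsg_exchange ij).
- apply: (IHN (fun l => n l - (l == i))%N m).
  + by apply: leq_trans ltN; rewrite ltn_add2r; apply: sum_pred.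
  + by move=> l; case: (dis l) => ->; [left|right].
  + by move: Sn; rewrite (zcomb_pred ni) addrA addrAC.
  + by rewrite addrAC; apply: zsgD => //; apply: zsg_gen.
- apply: (IHN n (fun l => m l - (l == j))%N).
  + by apply: leq_trans ltN; rewrite ltn_add2l; apply: sum_pred.
  + by move=> l; case: (dis l) => ->; [left|right].
  + by rewrite addrAC; apply: zsgD => //; apply: zsg_gen.
  + by move: Sm; rewrite (zcomb_pred mj) addrA addrAC.
Qed.

(** Removing the positive part of [z] from [u], or the negative part from [v], gives the same [g],
    which is in [S]; the Apery property then forces both parts to vanish. *)
Lemma apery_inj u v z : apery S a u -> apery S a v -> r u = r v + zcomb z -> u = v.
Proof.
move=> Au Av uv; have [n [m [_ dis zE]]] := zcomb_posneg z.
pose g := r u - zcomb (fun i => (n i)%:Z).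
have un : r u = g + zcomb (fun i => (n i)%:Z) by rewrite subrK.
have vm : r v = g + zcomb (fun i => (m i)%:Z).
  by rewrite /g uv zE addrA addrAC addrK subrK.
have Sg : zS g.
  by apply: (zsg_disjoint dis); rewrite -?un -?vm; apply: apery_zsg.
have zero x p : apery S a x -> r x = g + zcomb (fun i => (p i)%:Z) ->
    forall i, p i = 0%N.
  move=> [_ Ax] xE i; apply/eqP; rewrite -leqn0 leqNgt; apply/negP => pi.
  apply: (Ax i); rewrite xE (zcomb_pred pi) addrA addrK.
  by apply: zsgD => //; apply: zsg_comb.
apply: (@mnm_row_inj int); rewrite un vm !zcomb0 //.
  exact: zero Av vm.
exact: zero Au un.
Qed.

Lemma zsg_aperyP v z : apery S a v -> zS (r v + zcomb z) <-> forall i, 0 <= z i.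
Proof.
move=> Av; split=> [/apery_decomp[u [n [Au E]]]|z0].
  have uv : u = v.
    apply: (@apery_inj u v (fun i => z i - (n i)%:Z)) => //.
    by rewrite zcombB addrA E addrK.
  by move=> i; move: E; rewrite uv => /addrI/zcomb_inj ->.
apply: zsgD; first exact: apery_zsg.
rewrite (_ : zcomb z = zcomb (fun i => `|z i|%N%:Z)); first exact: zsg_comb.
by apply: eq_bigr => i _; rewrite gez0_abs.
Qed.

(** Each of the finitely many remainders comes from at most one Apery element. *)
Lemma apery_bounded : exists N, forall v, apery S a v -> (mdeg v <= N)%N.
Proof.
have /choice[f Hf] : forall b, exists N, forall v, apery S a v ->
    is_remainder R a v b -> (mdeg v <= N)%N.
  move=> b; have [[v [Av rv]]|nex] :=
      pselect (exists v, apery S a v /\ is_remainder R a v b); last first.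
    by exists 0%N => v Av rv; case: nex; exists v.
  exists (mdeg v) => u Au ru; suff -> : u = v by [].
  have [_ [z zE]] := remainderP rv; have [_ [z' zE']] := remainderP ru.
  apply: (@apery_inj u v (fun i => z i - z' i)) => //.
  by rewrite zcombB addrA -zE zE' addrK.
pose B := mdeg (\sum_i a i)%MM.
exists (\max_(b : 'X_{1..d < B.+1}) f b) => v Av.
have [z zP] := fractional_part (r v).
have [b _ rb] := apery_remainder Av zP.
have ltb : (mdeg b < B.+1)%N by rewrite ltnS; apply: remainder_mdeg rb.
exact: leq_trans (Hf b v Av rb) (leq_bigmax (BMultinom ltb)).
Qed.

Lemma conductor_generated w : cone_max R S (apery S a) = [set w] ->
  generates R S
    [set r w - r b | b in cone_max R S (remainders R a (apery S a))]
    (conductor R S).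
Proof.
move=> hw; have [Aw _] : cone_max R S (apery S a) w by rewrite hw.
(* Uniqueness of the maximal element makes it a greatest one, since bounded degree puts some maximal
   element above each [v]. *)
have lew v i : apery S a v -> zcoord i (r v) <= zcoord i (r w).
  have [N AN] := apery_bounded; move=> /(cone_max_above AN)[u].
  by rewrite hw => -> /cone_leP.
apply/seteqP; split=> [c [Sc cS]|_ [_ [b [[v0 Av0 rv0] _] <-] [x /normalizationP[Gx x0] <-]]].
  have Gwc : sgroup S (r w - c) by apply: sgroupB; apply: zsg_sgroup => //; apply: apery_zsg.
  have [z zP] := fractional_part (r w - c); set g := _ - c in Gwc zP.
  have Ggz : sgroup S (g + zcomb z) by apply: sgroupD => //; apply: sgroup_comb.
  have Ngz : normalization R S (g + zcomb z).
    by apply/normalizationP; split=> // i; have /andP[] := zP i.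
  have [v [z' [Av vE]]] := sgroup_decomp Ggz.
  have [|y yE ry] := @apery_remainder v z' Av; first by rewrite -vE.
  have [||b mb /cone_leP yb] := @cone_max_above (remainders R a (apery S a))
      (mdeg (\sum_i a i)%MM) y.
  - by move=> x [u _]; apply: remainder_mdeg.
  - by exists v.
  exists (r w - r b); first by exists b.
  exists (c - (r w - r b)); last by rewrite addrC subrK.
  have [[u Au ru] _] := mb; have [_ [t bE]] := remainderP ru.
  apply/normalizationP; split=> [|i].
    apply: sgroupB; first exact: zsg_sgroup.
    apply: sgroupB; first exact/zsg_sgroup/apery_zsg.
    by rewrite bE; apply: sgroupD; [exact/zsg_sgroup/apery_zsg | exact: sgroup_comb].
  have := cS _ Ngz; have -> : c + (g + zcomb z) = r w + zcomb z.
    by rewrite addrA /g addrC [c + _]addrC subrK addrC.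
  (* Since [b] is above [y], the coordinates of [c - (w - b)] are at least those of [c - w + y],
     which are the integers [z i]. *)
  move=> /(zsg_aperyP _ Aw)/(_ i) zi.
  have := yb i; rewrite -yE -vE /g !zcoordB zcoordD !zcoordB zcoord_comb.
  have : 0 <= (z i)%:~R :> R by rewrite ler0z.
  lra.
have [b01 [t bE]] := remainderP rv0.
have Gw : sgroup S (r w) by apply/zsg_sgroup/apery_zsg.
have Gb : sgroup S (r b).
  by rewrite bE; apply: sgroupD; [exact/zsg_sgroup/apery_zsg | exact: sgroup_comb].
(* Used for [x], to get membership in [S], and for [x + h], to get stability under the
   normalization. *)
have key h : sgroup S h -> (forall i, 0 <= zcoord i h) -> zS (r w - r b + h).
  move=> Gh h0; have Gwbh : sgroup S (r w - r b + h).
    by apply: sgroupD => //; apply: sgroupB.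
  have [v [z [Av E]]] := sgroup_decomp Gwbh; rewrite E; apply/zsg_aperyP => // i.
  have /(congr1 (zcoord i)) := E.
  rewrite zcoordD zcoordB zcoordD zcoord_comb.
  have := lew _ i Av; have := h0 i; have /andP[_] := b01 i => h1 h2 h3 h4.
  (* As [v] lies below [w] and the coordinates of [b] are below 1, [z i] exceeds -1; integrality
     gives [0 <= z i]. *)
  by rewrite -ltzD1 -(ltr_int R) rmorphD /=; lra.
split=> [|h /normalizationP[Gh h0]]; first exact: key.
rewrite -addrA; apply: key; first exact: sgroupD.
by move=> i; rewrite zcoordD addr_ge0.
Qed.

End Exchange.

End Apery.

Theorem corollary4p17 (R : realType) (K : fieldType) (d : nat) (hd : (0 < d)%N)
    (S : affine_semigroup d) (a : 'I_d -> 'X_{1..d}) (w : 'X_{1..d})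
    (hS : simplicial S) (ha : extremal_rays R S a)
    (hCM : cohen_macaulay (semigroup_ring K S))
    (hw : cone_max R S (apery S a) = [set w]) :
  generates R S
    [set mnm_row int w - mnm_row int b
       | b in cone_max R S (remainders R a (apery S a))]
    (conductor R S)
  /\
  (forall b : 'X_{1..d},
     cone_max R S (remainders R a (apery S a)) = [set b] ->
     generates R S [set mnm_row int w - mnm_row int b] (conductor R S)).
Proof.
have ga := extremal_rays_gens hS ha.
have gen := conductor_generated ga (cohen_macaulay_exchange ga hCM) hw.
by split=> [//|b hb]; move: gen; rewrite hb image_set1.
Qed.
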